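(* Let $M$ be a matroid on a finite ground set $E$ and let $e \in E$. Then the matroid pair $(\mathrm{IN}(M-e), \mathrm{IN}(M/e))$ (an interval in $2^E$) satisfies the spectral recursion.
   Context: $E$ is a finite set and $2^E$ its Boolean algebra of subsets. A set $\Phi \subseteq 2^E$ is an interval if $F \subseteq G \subseteq H$ and $F,H \in \Phi$ imply $G \in \Phi$. Elements of the ground set $E$ are the vertices of $\Phi$ (a vertex need not lie in any face); members of $\Phi$ are its faces; $\dim F = |F|-1$. $\Phi_i$ is the set of $i$-dimensional faces, $i \ge -1$. A simplicial complex is a (possibly empty) set $\Delta \subseteq 2^E$ closed under taking subsets; for simplicial complexes $\Delta' \subseteq \Delta$, the relative simplicial pair $(\Delta,\Delta')$ denotes the set difference $\Delta \setminus \Delta'$, which is an interval. For an interval $\Phi$ and $e \in E$: the deletion is $\Phi - e = \{F \in \Phi : e \notin F\}$, the contraction is $\Phi/e = \{F \setminus \{e\} : F \in \Phi,\ e \in F\}$, the star is $\mathrm{st}_\Phi e = \bigcup \{F, F \cup \{e\}\}$ over all $F$ with $e \notin F$ and $F, F\cup\{e\} \in \Phi$, and the reduction is $\Phi \| e = \Phi \setminus \mathrm{st}_\Phi e$. Each of $\Phi-e$, $\Phi/e$, $\Phi\|e$ is again an interval in $2^E$. For a matroid $M$, $\mathrm{IN}(M)$ is the simplicial complex of independent sets of $M$. Deletion and contraction are taken consistently with those of intervals: $\mathrm{IN}(M-e) = \mathrm{IN}(M)-e$ and $\mathrm{IN}(M/e) = \mathrm{IN}(M)/e$ (so $\mathrm{IN}(M/e)=\emptyset$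 when $e$ is a loop of $M$). Fix a total order on $E$. $C_i(\Phi;\mathbb{R})$ is the real vector space with basis $\Phi_i$; the boundary operator $\partial_i : C_i \to C_{i-1}$ sends $F = \{v_0 < \cdots < v_i\}$ to $\sum_j (-1)^j (F \setminus \{v_j\})$, the sum over those $j$ with $F\setminus\{v_j\} \in \Phi$. Let $\partial_i^*$ be its adjoint (transpose in these bases). The Laplacian is $L_i(\Phi) = \partial_{i+1}\partial_{i+1}^* + \partial_i^*\partial_i$ on $C_i(\Phi;\mathbb{R})$; its eigenvalues are non-negative reals and do not depend on the vertex order. $\mathbf{s}_i(\Phi)$ is the multiset of eigenvalues of $L_i(\Phi)$. The spectrum polynomial is the formal generating function $S_\Phi(t,q) = \sum_{i \ge 0} t^i \sum_{\lambda \in \mathbf{s}_{i-1}(\Phi)} q^\lambda$ (formal sums of $q^\lambda$ with real exponents $\lambda \ge 0$). $\Phi$ satisfies the spectral recursion with respect to a vertex $v \in E$ if $S_\Phi(t,q) = q\,S_{\Phi-v}(t,q) + qt\,S_{\Phi/v}(t,q) + (1-q)\,S_{\Phi\|v}(t,q)$. $\Phi$ satisfies the spectral recursion if it does so with respect to every vertex $v \in E$. *)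

(* Defs.v *)
From HB Require Import structures.
From mathcomp Require Import all_boot all_order all_algebra.
From mathcomp Require Import reals complex polyrcf.
From mathcomp.multinomials Require Import monalg.

Set Implicit Arguments.
Unset Strict Implicit.
Unset Printing Implicit Defensive.

Import Order.TTheory GRing.Theory Num.Theory.
Local Open Scope ring_scope.

Section Intervals.
Variable E : finType.
Implicit Types (Phi Delta : {set {set E}}) (e : E).

Definition is_interval Phi : Prop :=
  forall F G H : {set E},
    F \subset G -> G \subset H -> F \in Phi -> H \in Phi -> G \in Phi.

Definition deletion Phi e : {set {set E}} := [set F in Phi | e \notin F].

Definition contraction Phi e : {set {set E}} :=
  [set F :\ e | F : {set E} in Phi & e \in F].

Definition star Phi e : {set {set E}} :=
  \bigcup_(F in Phi | (e \notin F) && (e |: F \in Phi)) [set F; e |: F].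

Definition reduction Phi e : {set {set E}} := Phi :\: star Phi e.

Definition relative_pair Delta Delta' : {set {set E}} := Delta :\: Delta'.

Record matroid := Matroid {
  IN :> {set {set E}};
  indep0 : set0 \in IN;
  indepS : forall I J : {set E}, I \subset J -> J \in IN -> I \in IN;
  indep_exchange : forall I J : {set E}, I \in IN -> J \in IN ->
    (#|I| < #|J|)%N -> exists2 x, x \in J :\: I & x |: I \in IN
}.

(* IN(M - e) and IN(M / e) are, by convention, the deletion and contraction of
   the complex IN(M); hence IN(M / e) is empty (and not the complex of a
   matroid) when e is a loop of M. *)
Definition IN_del (M : matroid) e : {set {set E}} := deletion (IN M) e.
Definition IN_contr (M : matroid) e : {set {set E}} := contraction (IN M) e.

End Intervals.

Section Laplacian.
Variables (R : realType) (d : Order.disp_t) (E : finOrderType d).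
Implicit Types (Phi : {set {set E}}) (k : nat).

(* Faces are graded by cardinality k = dim + 1, so that the index -1 of the
   empty face becomes k = 0: [faces Phi k] is Phi_(k-1). *)
Definition faces Phi k : {set {set E}} := [set F in Phi | #|F| == k].

(* If v = v_j in F = {v_0 < ... < v_i}, then j is the number of u < v in F. *)
Definition vertex_rank (F : {set E}) (v : E) : nat :=
  #|[set u in F | (u < v)%O]|.

(* The matrix (acting on column vectors) of the boundary operator from
   C_(k-1) to C_(k-2).  For k = 0 the index k.-1 is again 0, but the only
   possible face is then empty and has no vertex, so the matrix is zero. *)
Definition boundary Phi k : 'M[R]_(#|faces Phi k.-1|, #|faces Phi k|) :=
  \matrix_(i, j)
    let G : {set E} := enum_val i in let F : {set E} := enum_val j in
    \sum_(v in F | F :\ v == G) (-1) ^+ vertex_rank F v.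

(* The matrix of L_(k-1). *)
Definition laplacian Phi k : 'M[R]_(#|faces Phi k|) :=
  boundary Phi k.+1 *m (boundary Phi k.+1)^T
  + (boundary Phi k)^T *m boundary Phi k.

(* The multiset s_(k-1): the real eigenvalues, each repeated according to its
   multiplicity as a root of the characteristic polynomial.  No eigenvalue is
   lost by this, see [char_poly_laplacian] and [spectrum_ge0]. *)
Definition spectrum Phi k : seq R :=
  let p := char_poly (laplacian Phi k) in
  flatten [seq nseq (mup a p) a | a <- rootsR p].


Lemma laplacian_gram Phi k :
  let B := col_mx (boundary Phi k.+1)^T (boundary Phi k) in
  laplacian Phi k = B^T *m B.
Proof. by rewrite /= tr_col_mx mul_row_col trmxK. Qed.

Lemma char_poly_laplacian Phi k :
  char_poly (laplacian Phi k) = \prod_(a <- spectrum Phi k) ('X - a%:P).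
Proof.
rewrite /spectrum; set L := laplacian Phi k; set n := #|faces Phi k|.
have [s Ls] : exists s : seq R, char_poly L = \prod_(a <- s) ('X - a%:P).
  have symL : L^T = L by rewrite /L laplacian_gram trmx_mul trmxK.
  pose A : 'M[R[i]]_n := map_mx (real_complex R) L.
  have hA : A \is hermsymmx.
    apply: realsym_hermsym.
      apply/is_hermitianmxP; rewrite expr0 scale1r map_mx_id//.
      by rewrite /A -{1}symL; apply/matrixP => i j; rewrite !mxE.
    by apply/mxOverP => i j; rewrite mxE complex_real.
  have /orthomx_spectralP := hermitian_normalmx hA.
  have /mxOverP := hermitian_spectral_diag_real hA.
  have := spectral_unit A.
  move: (spectralmx A) (spectral_diag A) => P D uP rD eA.
  exists [seq complex.Re (D 0 i) | i <- enum 'I_n].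
  apply: (map_poly_inj (real_complex R)); rewrite map_char_poly -/A.
  have -> : char_poly A = char_poly (diag_mx D).
    pose c := map_mx (@polyC R[i]).
    have cP : c _ _ (invmx P) *m c _ _ P = 1%:M.
      by rewrite -map_mxM mulVmx// map_mx1.
    rewrite /char_poly {1}eA.
    have -> : char_poly_mx (invmx P *m diag_mx D *m P)
      = c _ _ (invmx P) *m char_poly_mx (diag_mx D) *m c _ _ P.
      rewrite /char_poly_mx mulmxBr mulmxBl !map_mxM; congr (_ - _).
      by rewrite mul_mx_scalar -scalemxAl cP scalemx1.
    by rewrite !det_mulmx mulrAC -det_mulmx cP det1 mul1r.
  rewrite char_poly_trig ?diag_mx_is_trig// rmorph_prod big_map big_enum/=.
  apply: eq_bigr => i _; rewrite rmorphB/= map_polyX map_polyC/= mxE eqxx.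
  by rewrite mulr1n RRe_real// rD.
rewrite {1}Ls; apply/perm_big/allP => x _ /=; apply/eqP.
have L0 : char_poly L != 0 by rewrite monic_neq0 ?char_poly_monic.
have rootL y : (y \in rootsR (char_poly L)) = (y \in s).
  by rewrite -roots_on_rootsR// inE/= Ls root_prod_XsubC.
rewrite count_flatten -map_comp; have [xs|xs] := boolP (x \in s).
  rewrite (eq_map (g := fun a => (if a == x then count_mem x s else 0)%N));
    last first.
    move=> a /=; rewrite count_nseq/= eq_sym; case: eqP => [->|_]; last by [].
    by rewrite mul1n Ls mu_prod_XsubC.
  rewrite sumnE big_map -big_mkcond/= big_const_seq.
  suff -> : count (xpred1 x) (rootsR (char_poly L)) = 1%N by rewrite /= addn0.
  by rewrite count_uniq_mem ?uniq_roots// rootL xs.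
rewrite (count_memPn xs); symmetry; apply/eqP; rewrite sumnE big_map big1_seq//.
move=> a; rewrite rootL => /andP[_ as_]; rewrite /= count_nseq /=.
by case: eqP xs as_ => [->|//] /negbTE->.
Qed.

Lemma spectrum_ge0 Phi k : {in spectrum Phi k, forall a, 0 <= a}.
Proof.
move=> a; rewrite -root_prod_XsubC -char_poly_laplacian -eigenvalue_root_char.
move=> /eigenvalueP[v]; rewrite laplacian_gram; set B := col_mx _ _.
move=> vB v0; pose sq m (w : 'rV[R]_m) := (w *m w^T) 0 0.
have sqE m (w : 'rV[R]_m) : sq m w = \sum_i w 0 i ^+ 2.
  by rewrite /sq mxE; apply: eq_bigr => i _; rewrite mxE expr2.
have sq_ge0 m (w : 'rV[R]_m) : 0 <= sq m w.
  by rewrite sqE sumr_ge0// => i _; rewrite sqr_ge0.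
have sqv : 0 < sq _ v.
  rewrite lt_def sq_ge0 andbT sqE psumr_neq0; last by move=> *; exact: sqr_ge0.
  have /rV0Pn[i vi0] := v0.
  by apply/hasP; exists i; rewrite ?mem_index_enum// exprn_even_gt0.
have : sq _ (v *m B^T) = a * sq _ v.
  by rewrite /sq trmx_mul trmxK mulmxA -[v *m _ *m _]mulmxA vB -scalemxAl mxE.
by move=> eq_sq; rewrite -(pmulr_lge0 _ sqv) -eq_sq.
Qed.

End Laplacian.

(* The exponents of q: non-negative reals, as an additively written monoid. *)
Section Exponents.
Variable R : realType.

Record exponent := Exponent { exponent_val :> R; _ : 0 <= exponent_val }.

HB.instance Definition _ := [isSub for exponent_val].
HB.instance Definition _ := [Choice of exponent by <:].

Fact exponent_add_subproof (a b : exponent) : 0 <= val a + val b.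
Proof. by case: a b => [a a0] [b b0]; rewrite addr_ge0. Qed.

Definition exponent0 : exponent := Exponent (lexx 0).
Definition exponent1 : exponent := Exponent ler01.
Definition exponent_add (a b : exponent) : exponent :=
  Exponent (exponent_add_subproof a b).

Fact exponent_addA : associative exponent_add.
Proof. by move=> a b c; apply: val_inj; rewrite /= addrA. Qed.
Fact exponent_addC : commutative exponent_add.
Proof. by move=> a b; apply: val_inj; rewrite /= addrC. Qed.
Fact exponent_add0 : left_id exponent0 exponent_add.
Proof. by move=> a; apply: val_inj; rewrite /= add0r. Qed.
Fact exponent_addr0 : right_id exponent0 exponent_add.
Proof. by move=> a; rewrite exponent_addC exponent_add0. Qed.
Fact exponent_add_eq0 (a b : exponent) :
  exponent_add a b = exponent0 -> a = exponent0 /\ b = exponent0.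
Proof.
case: a b => [a a0] [b b0] /(congr1 val)/= /eqP.
by rewrite paddr_eq0// => /andP[/eqP a_0 /eqP b_0]; split; apply: val_inj.
Qed.

HB.instance Definition _ := Choice_isMonomialDef.Build exponent
  exponent_addA exponent_add0 exponent_addr0 exponent_add_eq0.
HB.instance Definition _ := MonomialDef_isConomialDef.Build exponent
  exponent_addC.

End Exponents.

Section SpectrumPolynomial.
Variables (R : realType) (d : Order.disp_t) (E : finOrderType d).
Implicit Types (Phi : {set {set E}}) (v : E).

(* Polynomials in t over the finite formal sums of q^lambda, lambda >= 0. *)
Definition qt_poly := {poly {malg int[exponent R]}}.

Definition q_var : qt_poly := (<< exponent1 R >>)%:P.
Definition t_var : qt_poly := 'X.

(* The coefficients of t^k vanish for k > #|E|, as there are no faces of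
   cardinality k; [pmap insub] only retypes the (non-negative) eigenvalues. *)
Definition spectrum_poly Phi : qt_poly :=
  \sum_(k < #|E|.+1)
    t_var ^+ k *
    (\sum_(a <- pmap insub (spectrum R Phi k) : seq (exponent R)) << a >>)%:P.

Definition spectral_recursion_at Phi v : Prop :=
  spectrum_poly Phi =
    q_var * spectrum_poly (deletion Phi v)
    + q_var * t_var * spectrum_poly (contraction Phi v)
    + (1 - q_var) * spectrum_poly (reduction Phi v).

Definition spectral_recursion Phi : Prop :=
  forall v : E, spectral_recursion_at Phi v.

End SpectrumPolynomial.

(* Main.v *)
(* For an independent set I, the Laplacian of IN(M) only links I to independent
   sets with the same span, so it is block diagonal over the flats G of M, the
   block of G being |E \ G| plus the Laplacian of the restriction to G.  This
   persists for a family Phi of independent sets closed under independent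
   extensions and under the meet of two of its members whose join is
   independent (here: the I avoiding e whose span contains e), and for its
   deletion, contraction and reduction at v.  Hence the t^k-coefficient of the
   defect of the recursion is a combination, over the flats of rank k
   containing v, of the defects of the restrictions of Phi, and by induction on
   the rank only the top coefficient may be nonzero.  At t = -1 the spectrum
   polynomial of an interval is its Euler characteristic, independently of q,
   since nonzero eigenvalues cancel in adjacent dimensions; so the defect
   vanishes at t = -1, and the top coefficient is zero too. *)
Require Import Defs.
From mathcomp Require Import all_boot all_order all_fingroup all_algebra reals.
From mathcomp Require Import polyrcf ring.
From mathcomp.multinomials Require Import monalg.

Set Implicit Arguments.
Unset Strict Implicit.
Unset Printing Implicit Defensive.

Import Order.TTheory GRing.Theory Num.Theory.
Local Open Scope ring_scope.

(** * Roots of characteristic polynomials *)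

Section RootGeneratingFunction.
Variable R : realType.
Implicit Types (p : {poly R}) (a : R).

(* Junk value 0 for a < 0. *)
Definition qpow a : {malg int[exponent R]} :=
  if insub a is Some x then << x >> else 0.

(** Products of polynomials become sums here, so factorizations of characteristic polynomials turn
    into linear identities between spectra. *)
Definition root_gf p : {malg int[exponent R]} :=
  \sum_(a <- rootsR p) qpow a *+ mup a p.

(** Points that are not roots have multiplicity 0; two polynomials can thus be summed over a common
    list. *)
Lemma root_gf_widen p (s : seq R) : p != 0 -> uniq s ->
  (forall a, root p a -> a \in s) -> root_gf p = \sum_(a <- s) qpow a *+ mup a p.
Proof.
move=> p0 us ps; rewrite (bigID (mem (rootsR p))) /= [X in _ + X]big1 ?addr0.
  rewrite -big_filter; apply/perm_big/uniq_perm.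
  - exact: uniq_roots.
  - exact: filter_uniq.
  move=> a; rewrite mem_filter -roots_on_rootsR// inE/=.
  by have [/ps->|] := boolP (root p a).
by move=> a; rewrite -roots_on_rootsR// inE/= => /mupNroot->; rewrite mulr0n.
Qed.

Lemma root_gfM p1 p2 : p1 != 0 -> p2 != 0 ->
  root_gf (p1 * p2) = root_gf p1 + root_gf p2.
Proof.
move=> p10 p20; pose s := undup (rootsR p1 ++ rootsR p2).
have rs i a : i \in [:: p1; p2] -> root i a -> a \in s.
  rewrite !inE mem_undup mem_cat -!roots_on_rootsR// !inE/=.
  by case/orP => /eqP-> ->; rewrite ?orbT.
rewrite !(@root_gf_widen _ s) ?undup_uniq ?mulf_neq0// => [|a|a|a].
- rewrite -big_split; apply: eq_bigr => a _.
  by rewrite mupM// mulrnDr.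
- by apply: rs; rewrite !inE eqxx orbT.
- by apply: rs; rewrite !inE eqxx.
by rewrite rootM => /orP[]; apply: rs; rewrite !inE eqxx ?orbT.
Qed.

Lemma root_gf1 : root_gf 1 = 0.
Proof. by rewrite /root_gf rootsRC big_nil. Qed.

Lemma root_gf_XsubC a : root_gf ('X - a%:P) = qpow a.
Proof.
rewrite (@root_gf_widen _ [:: a]) ?polyXsubC_eq0// => [|b].
  by rewrite big_seq1 (@mup_XsubCX _ 1) eqxx.
by rewrite root_XsubC inE.
Qed.

Lemma root_gf_prod (I : Type) (r : seq I) (P : pred I) (f : I -> {poly R}) :
  (forall i, f i \is monic) ->
  root_gf (\prod_(i <- r | P i) f i) = \sum_(i <- r | P i) root_gf (f i).
Proof.
move=> mf; elim: r => [|i r IHr]; first by rewrite !big_nil root_gf1.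
rewrite !big_cons; case: (P i) => //; rewrite root_gfM ?IHr ?monic_neq0//.
exact: monic_prod.
Qed.

Lemma qpow0 : qpow 0 = 1.
Proof.
rewrite /qpow; case: insubP => [x _ xE|]; last by rewrite lexx.
by congr << _ >>; apply: val_inj.
Qed.

Lemma qpowDn a n : 0 <= a -> qpow (a + n%:R) = << exponent1 R >> ^+ n * qpow a.
Proof.
elim: n a => [|n IHn] a a0; first by rewrite addr0 expr0 mul1r.
rewrite -natr1 addrA exprS -mulrA -IHn// /qpow.
have an0 : 0 <= a + n%:R by rewrite addr_ge0.
case: insubP => [x _ xE|]; last by rewrite addr_ge0.
case: insubP => [y _ yE|]; last by rewrite an0.
rewrite malgM_def fgmulUU mulr1; congr << _ >>; apply: val_inj => /=.
by rewrite xE addrC -yE.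
Qed.

Lemma root_gfXn n : root_gf 'X^n = n%:R.
Proof.
elim: n => [|n IHn]; first by rewrite root_gf1.
rewrite exprS root_gfM ?polyX_eq0 ?monic_neq0 ?monicXn// IHn.
by rewrite -['X]subr0 root_gf_XsubC qpow0 -nat1r.
Qed.

End RootGeneratingFunction.

(** * Characteristic polynomials of products, sums, shifts and blocks *)

Section CharPoly.

Lemma char_poly_reindex (F : comNzRingType) m n (f : 'I_m -> 'I_n)
    (A : 'M[F]_n) : bijective f -> char_poly (mxsub f f A) = char_poly A.
Proof.
move=> bf; have mn : m = n by have := bij_eq_card bf; rewrite !card_ord.
subst m; pose s := perm (bij_inj bf).
have -> : mxsub f f A = row_perm s (col_perm s A).
  by apply/matrixP => i j; rewrite !mxE !permE.
rewrite /char_poly.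
have -> : char_poly_mx (row_perm s (col_perm s A))
          = row_perm s (col_perm s (char_poly_mx A)).
  by apply/matrixP => i j; rewrite !mxE (inj_eq perm_inj).
rewrite row_permE col_permE !det_mulmx mulrCA -det_mulmx.
by rewrite -perm_mxM mulgV perm_mx1 det1 mulr1.
Qed.

Lemma char_poly_ublock (F : comNzRingType) m n (A : 'M[F]_m) B (D : 'M[F]_n) :
  char_poly (block_mx A B 0 D) = char_poly A * char_poly D.
Proof.
rewrite /char_poly /char_poly_mx scalar_mx_block map_block_mx opp_block_mx.
by rewrite add_block_mx map_mx0 subr0 det_ublock.
Qed.

(** Sylvester's identity. The matrix with blocks X, A, B, 1 is made block triangular from the right
    and from the left, which computes its determinant in two ways. *)
Lemma char_poly_mulmxC (F : comNzRingType) m n (A : 'M[F]_(m, n)) B :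
  char_poly (A *m B) * 'X^n = char_poly (B *m A) * 'X^m.
Proof.
pose c p q := @map_mx F {poly F} polyC p q.
have e1 : block_mx 'X%:M (c _ _ A) (c _ _ B) 1%:M
          *m block_mx 1%:M 0 (- c _ _ B) 1%:M
          = block_mx ('X%:M - c _ _ (A *m B)) (c _ _ A) 0 1%:M.
  rewrite mulmx_block !mulmx1 !mulmx0 !mul1mx add0r mulmxN -map_mxM.
  by rewrite subrr add0r.
have e2 : block_mx 1%:M 0 (- c _ _ B) 'X%:M
          *m block_mx 'X%:M (c _ _ A) (c _ _ B) 1%:M
          = block_mx 'X%:M (c _ _ A) 0 ('X%:M - c _ _ (B *m A)).
  rewrite mulmx_block !mul1mx !mul0mx !addr0 mulmx1 !mulNmx -map_mxM.
  by rewrite mul_scalar_mx mul_mx_scalar addNr [- _ + _]addrC.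
have := congr1 determinant e1; have := congr1 determinant e2.
rewrite !det_mulmx !det_ublock !det_lblock !det1 !det_scalar !mul1r !mulr1.
by move=> d2 d1; rewrite /char_poly /char_poly_mx -d1 mulrC d2 mulrC.
Qed.

(** When [A *m B = 0], (X - A)(X - B) = X (X - (A + B)). It will separate the two summands of a
    Laplacian. *)
Lemma char_poly_addmx (F : idomainType) n (A B : 'M[F]_n) : A *m B = 0 ->
  char_poly (A + B) * 'X^n = char_poly A * char_poly B.
Proof.
move=> AB0; rewrite /char_poly -det_mulmx -det_scalar -det_mulmx; congr (\det _).
rewrite /char_poly_mx [RHS]mulmxBr !mulmxBl.
have -> : map_mx polyC A *m map_mx polyC B = 0 by rewrite -map_mxM AB0 map_mx0.
by rewrite subr0 map_mxD mulmxDl opprD addrA -[X in _ = _ - X]scalar_mxC.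
Qed.

Lemma char_poly_shift (F : comNzRingType) n (A : 'M[F]_n) c :
  char_poly (A + c%:M) = char_poly A \Po ('X - c%:P).
Proof.
rewrite /char_poly -det_map_mx; congr (\det _); apply/matrixP => i j.
rewrite !mxE /= rmorphB /= comp_polyC rmorphMn/= comp_polyX polyCD.
by rewrite polyCMn mulrnBl opprD addrA addrAC.
Qed.

End CharPoly.

Lemma char_poly_dim0 (F : comNzRingType) n (A : 'M[F]_n) :
  n = 0%N -> char_poly A = 1.
Proof. by move=> n0; subst n; rewrite /char_poly det_mx00. Qed.

(** * Matrices indexed by finite sets *)

Section SetMatrix.
Variables (T : finType) (F : comNzRingType) (K : T -> T -> F).
Implicit Types A B : {set T}.

(** The kernel [K] lives on the whole type, so that a block is obtained by shrinking the index set
    alone. *)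
Definition set_mx A : 'M[F]_#|A| :=
  \matrix_(i, j) K (enum_val i) (enum_val j).

(** The cardinality bound makes [g] an enumeration of [A]; changing the enumeration only conjugates
    by a permutation. *)
Lemma char_poly_set_mx_inj m (g : 'I_m -> T) A :
  injective g -> (forall i, g i \in A) -> (#|A| <= m)%N ->
  char_poly (\matrix_(i, j) K (g i) (g j)) = char_poly (set_mx A).
Proof.
move=> injg gA leA; pose f i := enum_rank_in (gA i) (g i).
have fK i : enum_val (f i) = g i by rewrite enum_rankK_in.
have bf : bijective f.
  apply: inj_card_bij; last by rewrite !card_ord.
  by move=> i j /(congr1 enum_val); rewrite !fK => /injg.
rewrite -(char_poly_reindex (set_mx A) bf); congr char_poly.
by apply/matrixP => i j; rewrite !mxE !fK.
Qed.

Lemma char_poly_set_mxU A B : [disjoint A & B] ->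
  (forall x y, x \in B -> y \in A -> K x y = 0) ->
  char_poly (set_mx (A :|: B)) = char_poly (set_mx A) * char_poly (set_mx B).
Proof.
move=> dAB K0; pose g (i : 'I_(#|A| + #|B|)) : T :=
  match split i with inl j => enum_val j | inr j => enum_val j end.
have gl i : g (lshift _ i) = enum_val i by rewrite /g (unsplitK (inl _)).
have gr i : g (rshift _ i) = enum_val i by rewrite /g (unsplitK (inr _)).
have gA (i : 'I_#|A|) : enum_val i \in A by apply: enum_valP.
have gB (i : 'I_#|B|) : enum_val i \in B by apply: enum_valP.
rewrite -(@char_poly_set_mx_inj _ g).
- pose Kur : 'M[F]_(#|A|, #|B|) := \matrix_(i, j) K (enum_val i) (enum_val j).
  rewrite -(char_poly_ublock _ Kur); congr char_poly; apply/matrixP => i j.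
  rewrite -[i]splitK -[j]splitK.
  case: (split i) => i'; case: (split j) => j' /=;
    rewrite ?(block_mxEul, block_mxEur, block_mxEdl, block_mxEdr) !mxE ?gl ?gr //.
  by rewrite K0.
- move=> i j; rewrite -[i]splitK -[j]splitK.
  case: (split i) => i'; case: (split j) => j' /=; rewrite ?gl ?gr.
  + by move=> /enum_val_inj->.
  + by move=> eij; have := disjointFr dAB (gA i'); rewrite eij gB.
  + by move=> eij; have := disjointFr dAB (gA j'); rewrite -eij gB.
  by move=> /enum_val_inj->.
- move=> i; rewrite -[i]splitK inE.
  by case: (split i) => i' /=; rewrite ?gl ?gr ?gA ?gB ?orbT.
by rewrite cardsU leq_subr.
Qed.

Lemma char_poly_set_mx_partition (L : finType) (c : T -> L) (S : {set L}) A :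
  {in A, forall x, c x \in S} ->
  {in A &, forall x y, c x != c y -> K x y = 0} ->
  char_poly (set_mx A) =
    \prod_(l in S) char_poly (set_mx [set x in A | c x == l]).
Proof.
move=> cS K0; rewrite -big_enum /=.
have AE : A = [set x in A | c x \in enum S].
  by apply/setP => x; rewrite inE mem_enum; case: (boolP (x \in A)) => // /cS.
transitivity (char_poly (set_mx [set x in A | c x \in enum S])).
  by rewrite -AE.
(* Each label of the list splits off one block. Its elements are disjoint from those of the
   remaining labels because [enum S] is duplicate-free. *)
elim: (enum S) (enum_uniq S) => [_|l s IHs /= /andP[ls us]].
  rewrite big_nil char_poly_dim0//.
  by apply/eqP; rewrite cards_eq0; apply/eqP/setP => x; rewrite !inE andbF.
rewrite big_cons -IHs// -char_poly_set_mxU.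
- by congr (char_poly (set_mx _)); apply/setP => x; rewrite !inE -andb_orr.
- rewrite disjoint_subset; apply/subsetP => x; rewrite !inE => /andP[-> /eqP->].
  by rewrite ls.
move=> x y; rewrite !inE => /andP[xA cx] /andP[yA /eqP cy].
by apply: K0 => //; apply: contraNneq ls; rewrite -cy => <-.
Qed.

End SetMatrix.

(** * Laplacians of families of sets *)

Definition restriction (E : finType) (Phi : {set {set E}}) (G : {set E}) :=
  [set F in Phi | F \subset G].

Section Incidence.
Variables (R : realType) (d : Order.disp_t) (E : finOrderType d).
Implicit Types (Phi : {set {set E}}) (F G H I J K : {set E}) (a b x : E).

(** The entry of the boundary matrix, freed from the family of faces: the same signs serve a family
    and all its restrictions. *)
Definition incidence G F : R :=
  \sum_(v in F | F :\ v == G) (-1) ^+ vertex_rank F v.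

Lemma incidence_neq0 G F : incidence G F != 0 -> exists2 x, x \notin G & F = x |: G.
Proof.
move=> nz; suff /existsP[x /andP[xF /eqP FG]] : [exists x, (x \in F) && (F :\ x == G)].
  by exists x; rewrite -FG ?setD1K// !inE eqxx.
apply: contraNT nz => /existsPn noF; rewrite /incidence big_pred0// => x.
exact/negbTE.
Qed.

Lemma vertex_rankU1 F x y :
  x \notin F -> vertex_rank (x |: F) y = ((x < y)%O + vertex_rank F y)%N.
Proof.
move=> xF; rewrite /vertex_rank -!sum1dep_card /= big_mkcondr big_setU1//=.
by rewrite -big_mkcondr /=; case: ifP.
Qed.

Lemma incidenceU1 G x : x \notin G -> incidence G (x |: G) = (-1) ^+ vertex_rank G x.
Proof.
move=> xG; rewrite /incidence (big_pred1 x) ?vertex_rankU1 ?ltxx// => y /=.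
rewrite in_setU1; have [->|yx] /= := eqVneq y x; first by rewrite setU1K ?eqxx.
have [yG|//] := boolP (y \in G); apply/eqP => /setP/(_ y).
by rewrite !inE eqxx yG.
Qed.

Lemma incidence_sqr G x : x \notin G -> incidence G (x |: G) ^+ 2 = 1.
Proof. by move=> xG; rewrite incidenceU1// sqrr_sign. Qed.

(** The two paths from [K] to [b |: (a |: K)] carry opposite signs, since exactly one of a < b and b
    < a holds. This is the entrywise form of the vanishing of the squared boundary. *)
Lemma incidence_diamond K a b : a \notin K -> b \notin K -> a != b ->
  incidence K (a |: K) * incidence (a |: K) (b |: (a |: K)) +
  incidence K (b |: K) * incidence (b |: K) (b |: (a |: K)) = 0.
Proof.
move=> aK bK ab; rewrite {2}setUCA !incidenceU1 ?inE ?negb_or ?bK ?aK ?ab//=;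
  last by rewrite eq_sym ab.
rewrite !vertex_rankU1//; move: (vertex_rank _ a) (vertex_rank _ b) => m n.
rewrite -!exprD; case: (ltgtP a b) ab => // _ _ /=; rewrite add1n add0n addnS.
  by rewrite exprS mulN1r addnC addNr.
by rewrite exprS mulN1r addnC addrN.
Qed.

(** No cardinality is imposed on [H] and [K]: incidences vanish between sets whose sizes do not
    differ by one. *)
Definition laplacian_kernel Phi I J : R :=
  \sum_(H in Phi) incidence I H * incidence J H +
  \sum_(K in Phi) incidence K I * incidence K J.

Lemma incidence_card G F : incidence G F != 0 -> #|F| = #|G|.+1.
Proof. by move=> /incidence_neq0[x xG ->]; rewrite cardsU1 xG. Qed.

Lemma incidence_eq0 G F : #|F| != #|G|.+1 -> incidence G F = 0.
Proof. by move=> FG; apply/eqP; apply: contraNT FG => /incidence_card->. Qed.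

Lemma laplacian_set_mx Phi k :
  laplacian R Phi k = set_mx (laplacian_kernel Phi) (faces Phi k).
Proof.
have facek (i : 'I_#|faces Phi k|) : #|(enum_val i : {set E})| = k.
  by have := enum_valP i; rewrite inE => /andP[_ /eqP].
apply/matrixP => i j; rewrite !mxE /laplacian_kernel; congr (_ + _).
  rewrite [RHS](bigID [pred F : {set E} | #|F| == k.+1]) /= [X in _ + X]big1 ?addr0.
    rewrite (eq_bigl (fun F => F \in faces Phi k.+1)) => [|F]; last by rewrite /= inE.
    by rewrite [RHS]big_enum_val; apply: eq_bigr => l _; rewrite !mxE.
  by move=> F /andP[_ Fk]; rewrite incidence_eq0 ?mul0r// facek.
rewrite [RHS](bigID [pred F : {set E} | #|F| == k.-1]) /= [X in _ + X]big1 ?addr0.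
  rewrite (eq_bigl (fun F => F \in faces Phi k.-1)) => [|F]; last by rewrite /= inE.
  by rewrite [RHS]big_enum_val; apply: eq_bigr => l _; rewrite !mxE.
move=> F /andP[_ Fk]; rewrite incidence_eq0 ?mul0r// facek.
by apply: contraNneq Fk => ->.
Qed.

(** Distinct sets with a common coface or a common facet are the two middle elements of a diamond.
    The hypothesis says that such a diamond has both its bottom and its top in [Phi]. *)
Lemma laplacian_kernel_neq Phi I J :
  (forall K a b, a \notin K -> b \notin K -> a != b ->
     I = a |: K -> J = b |: K -> K \in Phi /\ b |: (a |: K) \in Phi) ->
  I != J -> laplacian_kernel Phi I J = 0.
Proof.
move=> diam IJ.
have up H : incidence I H * incidence J H != 0 ->
    exists K a b, [/\ a \notin K, b \notin K, a != b & I = a |: K /\ J = b |: K].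
  rewrite mulf_eq0 negb_or => /andP[/incidence_neq0[b bI ->] /incidence_neq0[a aJ e]].
  have ab : a != b.
    apply: contraNneq IJ => ab; rewrite -(setU1K bI) -(setU1K aJ) e ab//.
  have aI : a \in I.
    by have := setU11 a J; rewrite -e in_setU1 (negbTE ab).
  have IK := setD1K aI.
  exists (I :\ a), a, b; rewrite !inE eqxx ab (negbTE bI) andbF IK; split => //.
  split => //; rewrite -(setU1K aJ) -e.
  apply/setP => x; rewrite !inE.
  by have [->|] := eqVneq x b; rewrite ?andbT //= eq_sym ab.
have down K : incidence K I * incidence K J != 0 ->
    exists a b, [/\ a \notin K, b \notin K, a != b & I = a |: K /\ J = b |: K].
  rewrite mulf_eq0 negb_or => /andP[/incidence_neq0[a aK Ia] /incidence_neq0[b bK Jb]].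
  exists a, b; split=> //; apply: contraNneq IJ; rewrite Ia Jb => -> //.
(* Phi contains both I :|: J and I :&: J, whose terms cancel. *)
suff main K a b : a \notin K -> b \notin K -> a != b -> I = a |: K -> J = b |: K ->
    laplacian_kernel Phi I J = 0.
  have [/existsP[H /up[K [a [b [? ? ? []]]]]]|/existsPn nH] :=
    boolP [exists H, incidence I H * incidence J H != 0]; first exact: main.
  have [/existsP[K /down[a [b [? ? ? []]]]]|/existsPn nK] :=
    boolP [exists H, incidence H I * incidence H J != 0]; first exact: main.
  by rewrite /laplacian_kernel !big1 ?addr0// => F _; apply/eqP/negbNE.
move=> aK bK ab Ia Jb; have [KP HP] := diam K a b aK bK ab Ia Jb.
have cI : #|I| = #|K|.+1 by rewrite Ia cardsU1 aK.
have UE H : H != b |: (a |: K) -> incidence I H * incidence J H = 0.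
  move=> HE; apply/eqP; apply: contraNT HE.
  rewrite mulf_eq0 negb_or => /andP[nI nJ]; rewrite eq_sym eqEcard.
  rewrite (incidence_card nI) cI !cardsU1 !inE aK eq_sym (negbTE ab) bK leqnn andbT.
  have [[y _ HI] [x _ HJ]] := (incidence_neq0 nI, incidence_neq0 nJ).
  rewrite !subUset !sub1set {1}HJ Jb HI Ia !inE !eqxx !orbT/=.
  exact: subset_trans (subsetUr _ _) (subsetUr _ _).
have DE K' : K' != K -> incidence K' I * incidence K' J = 0.
  move=> KE; apply/eqP; apply: contraNT KE.
  rewrite mulf_eq0 negb_or => /andP[nI nJ]; rewrite eqEcard.
  have := incidence_card nI; rewrite cI => -[->]; rewrite leqnn andbT.
  have [[y _ HI] [x _ HJ]] := (incidence_neq0 nI, incidence_neq0 nJ).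
  have -> : K = I :&: J.
    apply/setP => z; rewrite Ia Jb !inE; have [->|] := eqVneq z a => //=.
      by rewrite (negbTE ab) (negbTE aK).
    by case: (z \in K); rewrite ?orbT.
  by rewrite subsetI {1}HI HJ !subsetUr.
rewrite /laplacian_kernel (bigD1 (b |: (a |: K)))//= (bigD1 (P := mem Phi) K)//=.
rewrite !big1 ?addr0 => [|F /andP[_ /DE]|F /andP[_ /UE]]//.
have [s1 s4] := (incidence_sqr aK, incidence_sqr (x := a) (G := J)).
have HE : b |: I = a |: J by rewrite Ia Jb setUCA.
rewrite -Ia; have := incidence_diamond aK bK ab; rewrite -Ia -Jb HE => diamond.
have {}s4 : incidence J (a |: J) ^+ 2 = 1.
  by apply: s4; rewrite Jb !inE negb_or ab.
rewrite -Ia in s1.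
(* Signs square to 1, so this multiple of the diamond relation is exactly the sum of the two
   surviving terms. *)
transitivity (incidence K I * incidence J (a |: J) * 0); last by rewrite mulr0.
rewrite -diamond -[X in X + _]mul1r -[X in _ + X]mul1r -{1}s1 -s4.
ring.
Qed.

(** Restricting to [G] loses only the cofaces [x |: I] with [x] outside [G]. Such a set covers a
    single subset of [G], so the loss is diagonal, and each coface contributes a squared sign. *)
Lemma laplacian_kernel_restriction Phi G I J : I \subset G -> J \subset G ->
  laplacian_kernel Phi I J = laplacian_kernel (restriction Phi G) I J
    + #|[set x in ~: G | x |: I \in Phi]|%:R *+ (I == J).
Proof.
move=> IG JG; rewrite /laplacian_kernel (bigID [pred F : {set E} | F \subset G])/=.
rewrite [X in _ + X + _](_ : _ =
    #|[set x in ~: G | x |: I \in Phi]|%:R *+ (I == J)).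
  rewrite [X in _ + _ + X](bigID [pred F : {set E} | F \subset G])/=.
  rewrite [X in _ + (_ + X)]big1 => [|F /andP[_ FG]].
    rewrite addr0 addrAC; congr (_ + _ + _);
      by apply: eq_bigl => F; rewrite inE.
  rewrite (_ : incidence F I = 0) ?mul0r//; apply/eqP; apply: contraNT FG.
  by move=> /incidence_neq0[x _ IE]; rewrite (subset_trans _ IG)// IE subsetUr.
have [<-|IJ] /= := eqVneq I J; last first.
  rewrite big1 // => F /andP[_ FG]; apply/eqP; apply: contraNT IJ.
  rewrite mulf_eq0 negb_or => /andP[/incidence_neq0[x xI FI]].
  move=> /incidence_neq0[y yJ FJ].
  have xG : x \notin G.
    by apply: contraNN FG => xG; rewrite FI subUset sub1set xG.
  have xy : x = y.
    have := setU11 x I; rewrite -FI FJ in_setU1 => /orP[/eqP//|xJ].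
    by rewrite (subsetP JG) in xG.
  by rewrite -(setU1K xI) -(setU1K yJ) -FI -FJ xy.
rewrite mulr1n; set X := [set x in _ | _].
have XG x : x \in X -> x \notin I.
  by rewrite !inE => /andP[xG _]; apply: contraNN xG; apply: (subsetP IG).
rewrite (bigID (mem [set x |: I | x in X])) /= [X in _ + X]big1 ?addr0.
  rewrite (eq_bigl (fun F => F \in [set x |: I | x in X])) => [|F].
    rewrite big_imset /=; last first.
      move=> x y /XG xI /XG yI e; have := setU11 x I.
      by rewrite e in_setU1 (negbTE xI) orbF => /eqP.
    rewrite -sum1_card natr_sum; apply: eq_bigr => x /XG xI.
    by rewrite -expr2 incidence_sqr.
  rewrite andb_idl // => /imsetP[x]; rewrite !inE => /andP[xG xP] ->.
  by rewrite xP subUset sub1set (negbTE xG).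
move=> F /andP[/andP[FP FG] FX]; apply/eqP; apply: contraNT FX.
rewrite mulf_eq0 orbb => /incidence_neq0[x xI FI].
apply/imsetP; exists x => //; rewrite !inE -FI FP andbT.
by apply: contraNN FG => xG; rewrite FI subUset sub1set xG.
Qed.

End Incidence.

(** * Operations on intervals and their commutation with restriction *)

Section IntervalOperations.
Variable E : finType.
Implicit Types (Phi : {set {set E}}) (F G : {set E}) (v : E).

Lemma in_deletion Phi v F :
  (F \in deletion Phi v) = (F \in Phi) && (v \notin F).
Proof. by rewrite inE. Qed.

Lemma in_contraction Phi v F :
  (F \in contraction Phi v) = (v \notin F) && (v |: F \in Phi).
Proof.
apply/imsetP/andP => [[G]|[vF vFP]].
  by rewrite inE => /andP[GP vG] ->; rewrite !inE eqxx setD1K.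
by exists (v |: F); rewrite ?setU1K// inE vFP setU11.
Qed.

(** The star is made of the pairs that toggling [v] matches within [Phi]. *)
Lemma in_reduction Phi v F : (F \in reduction Phi v) =
  (F \in Phi) && ((if v \in F then F :\ v else v |: F) \notin Phi).
Proof.
rewrite inE andbC; have [FP /=|//] := boolP (F \in Phi); congr negb.
apply/bigcupP/idP => [[G /andP[GP /andP[vG vGP]]]|].
  by rewrite !inE => /orP[] /eqP->; rewrite ?(negbTE vG)// setU11 setU1K.
case: ifP => vF FvP.
  exists (F :\ v); last by rewrite !inE setD1K// eqxx orbT.
  by rewrite FvP !inE eqxx setD1K.
by exists F; rewrite ?inE ?eqxx// FP vF.
Qed.

Lemma deletion_interval Phi v : is_interval Phi -> is_interval (deletion Phi v).
Proof.
move=> iP F G H FG GH; rewrite !inE => /andP[FP vF] /andP[HP vH].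
by rewrite (iP _ _ _ FG GH)//=; apply: contraNN vH => /(subsetP GH).
Qed.

Lemma contraction_interval Phi v :
  is_interval Phi -> is_interval (contraction Phi v).
Proof.
move=> iP F G H FG GH; rewrite !in_contraction => /andP[vF FP] /andP[vH HP].
by rewrite (contraNN (subsetP GH v))//= (iP _ _ _ (setUS _ FG) (setUS _ GH)).
Qed.

(** A partner of [G] in [Phi] would give one to an end of the chain: [H :\ v] lies between [G :\ v]
    and [H], or [v |: F] between [F] and [v |: G]. *)
Lemma reduction_interval Phi v : is_interval Phi -> is_interval (reduction Phi v).
Proof.
move=> iP F G H FG GH; rewrite !in_reduction => /andP[FP Fv] /andP[HP Hv].
rewrite (iP _ _ _ FG GH)//=; case: ifPn => vG.
  move: Hv; rewrite (subsetP GH v vG); apply: contraNN => GP.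
  exact: iP (setSD _ GH) (subsetDl _ _) GP HP.
have vF : v \notin F by apply: contraNN vG; apply: (subsetP FG).
move: Fv; rewrite (negbTE vF); apply: contraNN => GP.
exact: iP (subsetUr _ _) (setUS _ FG) FP GP.
Qed.

Lemma restriction_deletion Phi v G :
  restriction (deletion Phi v) G = deletion (restriction Phi G) v.
Proof. by apply/setP => F; rewrite !inE andbAC. Qed.

Lemma deletion_restriction_id Phi v G : v \notin G ->
  deletion (restriction Phi G) v = restriction Phi G.
Proof.
move=> vG; apply/setP => F; rewrite !inE andb_idr// => /andP[_ FG].
by apply: contraNN vG; apply: (subsetP FG).
Qed.

Lemma restriction_contraction Phi v G : v \in G ->
  restriction (contraction Phi v) G = contraction (restriction Phi G) v.
Proof.
move=> vG; apply/setP => F; rewrite inE !in_contraction inE subUset sub1set vG.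
by rewrite andbA.
Qed.

Lemma restriction_reduction Phi v G : v \in G ->
  restriction (reduction Phi v) G = reduction (restriction Phi G) v.
Proof.
move=> vG; apply/setP => F; rewrite inE !in_reduction !inE andbAC.
have [/andP[_ FG] /=|//] := boolP ((F \in Phi) && _).
have vFG : v |: F \subset G by rewrite subUset sub1set vG.
by case: ifP => _; rewrite ?vFG ?(subset_trans (subsetDl _ _) FG) andbT.
Qed.

End IntervalOperations.

(** * The Euler characteristic *)

Section EulerCharacteristic.
Variables (A : comNzRingType) (E : finType).
Implicit Types (Phi : {set {set E}}) (v : E).

Definition euler_char Phi : A := \sum_(F in Phi) (-1) ^+ #|F|.

Lemma euler_char_deletion_contraction Phi v :
  euler_char Phi = euler_char (deletion Phi v) - euler_char (contraction Phi v).
Proof.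
rewrite /euler_char (bigID (fun F : {set E} => v \notin F)) /=; congr (_ + _).
  by apply: eq_bigl => F; rewrite inE.
rewrite big_imset /= => [|F G]; last first.
  rewrite !inE => /andP[_ vF] /andP[_ vG] FG.
  by rewrite -(setD1K vF) FG setD1K.
rewrite -sumrN; apply: eq_big => [F|F /andP[_]]; first by rewrite inE negbK.
by rewrite negbK => vF; rewrite (cardsD1 v) vF exprS mulN1r.
Qed.

(** The star splits into pairs of opposite sign: reducing removes from both the deletion and the
    contraction their common part, which cancels. *)
Lemma euler_char_reduction Phi v : euler_char (reduction Phi v) = euler_char Phi.
Proof.
rewrite (euler_char_deletion_contraction _ v).
rewrite [RHS](euler_char_deletion_contraction _ v).
have -> : deletion (reduction Phi v) v = deletion Phi v :\: contraction Phi v.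
  apply/setP => F; rewrite in_setD in_contraction !in_deletion in_reduction.
  by case: (boolP (v \in F)); rewrite ?andbF ?andbT //= andbC.
have -> : contraction (reduction Phi v) v = contraction Phi v :\: deletion Phi v.
  apply/setP => F; rewrite in_setD !in_contraction !in_deletion in_reduction.
  by case: (boolP (v \in F)) => vF; rewrite ?andbF ?andbT //= setU11 setU1K// andbC.
rewrite /euler_char (big_setID (contraction Phi v) (A := deletion Phi v)) /=.
rewrite [X in _ = _ - X](big_setID (deletion Phi v)) /= setIC.
by rewrite opprD addrACA subrr add0r.
Qed.

End EulerCharacteristic.

(** * Localization of spectra and their alternating sum *)

Section Spectra.
Variables (R : realType) (d : Order.disp_t) (E : finOrderType d).
Implicit Types (Phi : {set {set E}}) (F G H I J K : {set E}) (a b x : E).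

Definition spectrum_gf Phi k : {malg int[exponent R]} :=
  root_gf (char_poly (laplacian R Phi k)).

Lemma spectrum_gfE Phi k : spectrum_gf Phi k =
  \sum_(a <- pmap insub (spectrum R Phi k) : seq (exponent R)) << a >>.
Proof.
rewrite /spectrum_gf char_poly_laplacian root_gf_prod => [|a]; last first.
  exact: monicXsubC.
elim: (spectrum R Phi k) => [|a s IHs]; first by rewrite !big_nil.
rewrite big_cons IHs root_gf_XsubC /qpow /=.
by case: insubP => [x _ _|_] /=; rewrite ?big_cons ?add0r.
Qed.

(** Eigenvalues are non-negative, so [qpow] never takes its junk value and a shift by [n] is a
    factor q^n. *)
Lemma root_gf_laplacian_shift Phi k n :
  root_gf (char_poly (laplacian R Phi k + n%:R%:M)) =
    << exponent1 R >> ^+ n * spectrum_gf Phi k.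
Proof.
rewrite char_poly_shift /spectrum_gf char_poly_laplacian rmorph_prod/=.
have shiftE (a : R) :
    ('X - a%:P) \Po ('X - n%:R%:P) = 'X - (a + n%:R)%:P :> {poly R}.
  by rewrite rmorphB/= comp_polyX comp_polyC polyCD opprD addrA addrAC.
under eq_bigr do rewrite shiftE.
rewrite !root_gf_prod => [|a|a]; try exact: monicXsubC.
rewrite mulr_sumr !big_seq; apply: eq_bigr => a /spectrum_ge0 a0.
by rewrite !root_gf_XsubC qpowDn.
Qed.

(** Block decomposition with the labelling [c] of the [k]-sets left abstract, to serve a family, its
    deletion, contraction and reduction alike. The diamond hypothesis kills the entries between
    different labels; the block of [G] is the Laplacian of the restriction, shifted by the number
    [m G] of extensions leaving [G]. *)
Lemma spectrum_gf_localize Phi k (c : {set E} -> {set E}) (S : {set {set E}})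
    (m : {set E} -> nat) :
  {in faces Phi k, forall I, c I \in S} ->
  {in faces Phi k & S, forall I G, (I \subset G) = (c I == G)} ->
  {in faces Phi k, forall I,
    #|[set x in ~: c I | x |: I \in Phi]| = m (c I)} ->
  (forall K a b, a \notin K -> b \notin K -> a != b ->
    a |: K \in faces Phi k -> b |: K \in faces Phi k ->
    c (a |: K) != c (b |: K) -> K \in Phi /\ b |: (a |: K) \in Phi) ->
  spectrum_gf Phi k =
    \sum_(G in S) << exponent1 R >> ^+ m G * spectrum_gf (restriction Phi G) k.
Proof.
move=> cS cP mP diam; rewrite /spectrum_gf laplacian_set_mx.
rewrite (char_poly_set_mx_partition cS); last first.
  move=> I J IP JP cIJ; apply: laplacian_kernel_neq => [K a b aK bK ab Ia Jb|].
    by apply: diam; rewrite -?Ia -?Jb.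
  by apply: contraNneq cIJ => ->.
rewrite root_gf_prod => [|G]; last exact: char_poly_monic.
apply: eq_bigr => G GS; rewrite -root_gf_laplacian_shift; congr root_gf.
have -> : [set I in faces Phi k | c I == G] = faces (restriction Phi G) k.
  apply/setP => I; rewrite !inE [RHS]andbAC; have [IP|//] := boolP ((I \in Phi) && _).
  by rewrite cP ?inE.
congr char_poly; rewrite laplacian_set_mx; apply/matrixP => i j; rewrite !mxE.
have := enum_valP i; have := enum_valP j.
rewrite -(inj_eq enum_val_inj) !inE => /andP[/andP[JP JG] Jk] /andP[/andP[IP IG] Ik].
rewrite (laplacian_kernel_restriction _ _ IG JG); congr (_ + _ *+ _); congr _%:R.
have IF : enum_val i \in faces Phi k by rewrite inE IP.
by move: IG; rewrite cP// => /eqP cI; rewrite -{1}cI mP// cI.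
Qed.

(** If one set between [K] and [H] contributes, the interval property puts the other middle set of
    the diamond in [Phi] too, and the two terms cancel. *)
Lemma boundary_boundary Phi k : is_interval Phi ->
  boundary R Phi k *m boundary R Phi k.+1 = 0.
Proof.
move=> iP; apply/matrixP => i j; rewrite !mxE.
have := enum_valP i; have := enum_valP j; rewrite !inE.
move eH : (enum_val j) => H; move eK : (enum_val i) => K /andP[HP _] /andP[KP _].
transitivity (\sum_(F in faces Phi k) incidence R K F * incidence R F H).
  by rewrite [RHS]big_enum_val; apply: eq_bigr => l _; rewrite !mxE eK eH.
have [/exists_inP[F0]|/exists_inPn noF] :=
  boolP [exists F in faces Phi k, incidence R K F * incidence R F H != 0]; last first.
  by rewrite big1// => F /noF/negbNE/eqP.
rewrite inE => /andP[F0P F0k]; rewrite mulf_eq0 negb_or => /andP[].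
move=> /incidence_neq0[a aK F0E] /incidence_neq0[b]; rewrite F0E in F0P F0k *.
rewrite in_setU1 negb_or => /andP[ba bK] HE.
have K_F : K \subset b |: K by rewrite subsetUr.
have F_H : b |: K \subset H by rewrite HE setUCA subsetUr.
have FP : b |: K \in faces Phi k.
  rewrite inE (iP _ _ _ K_F F_H)//=.
  by move: F0k; rewrite !cardsU1 aK bK.
have ab : a |: K != b |: K.
  apply/eqP => /setP/(_ a); rewrite !inE eqxx (negbTE aK) orbF.
  by rewrite eq_sym (negbTE ba).
rewrite (bigD1 (a |: K)) ?inE ?F0P//= (bigD1 (b |: K)) ?FP/= 1?eq_sym//.
rewrite big1 ?addr0 => [|F /andP[/andP[FPk Fa] Fb]].
  by rewrite HE incidence_diamond// eq_sym.
apply/eqP; apply: contraNT Fa; rewrite mulf_eq0 negb_or => /andP[].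
move=> /incidence_neq0[x xK FE] /incidence_neq0[y yF HE'].
have : x \in H by rewrite HE' FE !inE eqxx orbT.
rewrite HE !inE (negbTE xK) orbF => /orP[] /eqP xE; rewrite FE xE//.
by rewrite FE xE eqxx in Fb.
Qed.

(** The two summands of the Laplacian have product 0, and Sylvester's identity moves the first one
    to the faces of size [k.+1]. The powers of X account for the face count. *)
Lemma spectrum_gf_boundary Phi k : is_interval Phi ->
  spectrum_gf Phi k + #|faces Phi k.+1|%:R =
    root_gf (char_poly ((boundary R Phi k.+1)^T *m boundary R Phi k.+1)) +
    root_gf (char_poly ((boundary R Phi k)^T *m boundary R Phi k)).
Proof.
move=> iP; set B1 := boundary R Phi k.+1; set B0 := boundary R Phi k.
have cnz n (A : 'M[R]_n) : char_poly A != 0 by rewrite monic_neq0 ?char_poly_monic.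
have Xnz n : 'X^n != 0 :> {poly R} by rewrite monic_neq0 ?monicXn.
apply: (addIr (#|faces Phi k|%:R)).
have /(congr1 (@root_gf R)) : char_poly (laplacian R Phi k) * 'X^(#|faces Phi k|)
    = char_poly (B1 *m B1^T) * char_poly (B0^T *m B0).
  apply: char_poly_addmx; rewrite -mulmxA [B1^T *m _]mulmxA -trmx_mul.
  by rewrite boundary_boundary// trmx0 mul0mx mulmx0.
have /(congr1 (@root_gf R)) := char_poly_mulmxC B1 B1^T.
rewrite !root_gfM// !root_gfXn /spectrum_gf => sylv lap.
rewrite addrAC lap addrAC sylv /=.
by rewrite addrAC.
Qed.

Lemma spectrum_gf_euler Phi : is_interval Phi ->
  \sum_(k < #|E|.+1) (-1) ^+ k * spectrum_gf Phi k = euler_char _ Phi.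
Proof.
move=> iP.
pose P k := root_gf (char_poly ((boundary R Phi k)^T *m boundary R Phi k)).
have cards n : (#|E| < n)%N -> #|faces Phi n| = 0%N.
  move=> En; apply/eqP; rewrite cards_eq0; apply/eqP/setP => F; rewrite !inE.
  by rewrite (ltn_eqF (leq_ltn_trans (max_card _) En)) andbF.
(* Each [P k] occurs in two consecutive spectra with opposite signs, leaving the face counts and one
   boundary term. *)
have telescope n : \sum_(k < n) (-1) ^+ k * spectrum_gf Phi k =
    \sum_(k < n.+1) (-1) ^+ k * #|faces Phi k|%:R - (-1) ^+ n * P n.
  elim: n => [|n IHn].
    rewrite big_ord0 big_ord1 expr0 !mul1r.
    (* The boundary of the empty face is zero, so [P 0] consists of zero eigenvalues only. *)
    have -> : P 0%N = #|faces Phi 0|%:R; last by rewrite subrr.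
    rewrite /P; have -> : boundary R Phi 0 = 0; last first.
      rewrite mulmx0 /char_poly /char_poly_mx map_mx0 subr0 det_scalar.
      exact: root_gfXn.
    apply/matrixP => i j; rewrite !mxE /=; have := enum_valP j.
    rewrite inE cards_eq0 => /andP[_ /eqP ->].
    by rewrite big1// => v; rewrite inE.
  rewrite big_ord_recr IHn [in RHS]big_ord_recr /=.
  have := spectrum_gf_boundary n iP; rewrite -/(P _) -/(P _).
  move=> /(canRL (addrK _)) ->.
  by rewrite exprS; ring.
rewrite telescope [P _](_ : _ = 0) ?mulr0 ?subr0; last first.
  by rewrite /P char_poly_dim0 ?root_gf1// cards.
rewrite big_ord_recr /= cards// mulr0 addr0 /euler_char.
rewrite (partition_big (fun F : {set E} => inord #|F| : 'I_#|E|.+1) predT)//=.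
apply: eq_bigr => k _; rewrite -[#|faces Phi k|]sum1_card natr_sum mulr_sumr.
apply: eq_big => [F|F]; rewrite inE.
  congr (_ && _); rewrite -(inj_eq val_inj)/= inordK// ltnS; exact: max_card.
by move=> /andP[_ /eqP->]; rewrite mulr1.
Qed.

End Spectra.

(** * Matroids *)

Section MatroidSpan.
Variable E : finType.
Implicit Types (M : matroid E) (F G H I J K : {set E}) (a b x : E).

(* The matroid closure of I when I is independent, but all of E otherwise. *)
Definition mspan M I := [set x | (x \in I) || (x |: I \notin IN M)].

Lemma sub_mspan M I : I \subset mspan M I.
Proof. by apply/subsetP => x xI; rewrite inE xI. Qed.

Lemma mspan_mono M I J : I \subset J -> mspan M I \subset mspan M J.
Proof.
move=> IJ; apply/subsetP => x; rewrite !inE => /orP[/(subsetP IJ)->//|xI].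
by rewrite orbC (contraNN _ xI)//; apply: indepS; apply: setUS.
Qed.

Lemma mspan_rank M I J :
  I \in IN M -> J \in IN M -> J \subset mspan M I -> (#|J| <= #|I|)%N.
Proof.
move=> IM JM JI; rewrite leqNgt; apply/negP => /(indep_exchange IM JM)[x].
by rewrite inE => /andP[xI /(subsetP JI)]; rewrite inE (negbTE xI)/= => /negbTE->.
Qed.

(** An element spanned by one set but not by the other would extend the latter to an independent set
    exceeding the rank of the former's span. *)
Lemma mspan_eq M I J : I \in IN M -> J \in IN M -> #|I| = #|J| ->
  J \subset mspan M I -> mspan M J = mspan M I.
Proof.
have sub I' J' : I' \in IN M -> J' \in IN M -> #|I'| = #|J'| ->
    J' \subset mspan M I' -> mspan M I' \subset mspan M J'.
  move=> IM JM cIJ JI; apply/subsetP => x xI; rewrite inE.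
  have [//|xJ /=] := boolP (x \in J'); apply/negP => xJM.
  have : (#|x |: J'| <= #|I'|)%N.
    by apply: (mspan_rank IM xJM); rewrite subUset sub1set xI.
  by rewrite cardsU1 xJ cIJ ltnn.
move=> IM JM cIJ JI; have IJ := sub _ _ IM JM cIJ JI.
by apply/eqP; rewrite eqEsubset IJ sub// (subset_trans (sub_mspan M I)).
Qed.

(** Otherwise exchange from [b |: (a |: K)] extends [x |: K] by [a] or [b], against one of the two
    span hypotheses. *)
Lemma mspan_meet M K a b x : a \notin K -> b \notin K -> a != b ->
  b |: (a |: K) \in IN M -> x \in mspan M (a |: K) -> x \in mspan M (b |: K) ->
  x \in mspan M K.
Proof.
move=> aK bK ab abM xa xb; apply: contraT; rewrite inE negb_or negbK.
move=> /andP[xK xM].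
have : (#|x |: K| < #|b |: (a |: K)|)%N.
  by rewrite !cardsU1 xK aK !inE eq_sym (negbTE ab) bK.
move=> /(indep_exchange xM abM)[y]; rewrite !inE negb_or => /andP[/andP[yx yK]].
rewrite (negbTE yK) orbF => /orP[] /eqP yE yM; subst y.
  by move: xb; rewrite !inE setUCA yM orbF eq_sym (negbTE yx) (negbTE xK).
by move: xa; rewrite !inE setUCA yM orbF eq_sym (negbTE yx) (negbTE xK).
Qed.

Lemma restriction_indep0 M G : set0 \in restriction (IN M) G.
Proof. by rewrite inE indep0 sub0set. Qed.

Lemma restriction_indepS M G I J :
  I \subset J -> J \in restriction (IN M) G -> I \in restriction (IN M) G.
Proof.
by move=> IJ; rewrite !inE => /andP[/(indepS IJ)-> /(subset_trans IJ)].
Qed.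

Lemma restriction_exchange M G I J :
  I \in restriction (IN M) G -> J \in restriction (IN M) G -> (#|I| < #|J|)%N ->
  exists2 x, x \in J :\: I & x |: I \in restriction (IN M) G.
Proof.
rewrite !inE => /andP[IM IG] /andP[JM JG] /(indep_exchange IM JM)[x xJI xM].
exists x; rewrite // inE xM subUset sub1set IG (subsetP JG)//.
by move: xJI; rewrite inE => /andP[].
Qed.

(** The ground set stays [E], the elements outside [G] becoming loops; the induction on the rank
    then never changes the type. *)
Definition matroid_restriction M G : matroid E :=
  Matroid (restriction_indep0 M G) (@restriction_indepS M G)
    (@restriction_exchange M G).

Definition rank_flats M k := [set mspan M I | I : {set E} in IN M & #|I| == k].

Lemma mem_rank_flats M I : I \in IN M -> mspan M I \in rank_flats M #|I|.
Proof. by move=> IM; apply/imsetP; exists I; rewrite // inE IM eqxx. Qed.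

Lemma sub_rank_flat M k I G : I \in IN M -> #|I| = k -> G \in rank_flats M k ->
  (I \subset G) = (mspan M I == G).
Proof.
move=> IM Ik /imsetP[J]; rewrite inE => /andP[JM /eqP Jk] ->.
apply/idP/eqP => [|<-]; last exact: sub_mspan.
by apply: mspan_eq => //; rewrite Jk.
Qed.

End MatroidSpan.

(** * Families of independent sets for which the recursion localizes *)

Section ModularFilter.
Variable E : finType.
Implicit Types (M : matroid E) (Phi : {set {set E}}) (F G I J K : {set E}).
Implicit Types (a b v x : E).

(** The meet condition concerns only sets that differ by one exchange, the only ones that a
    Laplacian links. *)
Definition modular_filter M Phi : Prop :=
  [/\ Phi \subset IN M,
      forall I x, I \in Phi -> x |: I \in IN M -> x |: I \in Phi &
      forall K a b, a \notin K -> b \notin K -> a != b ->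
        a |: K \in Phi -> b |: K \in Phi -> b |: (a |: K) \in IN M -> K \in Phi].

(** Climb from [F] to [G] one element at a time: each set on the way is independent, being contained
    in [H]. *)
Lemma modular_filter_interval M Phi : modular_filter M Phi -> is_interval Phi.
Proof.
move=> [/subsetP PM up _] F G H FG GH FP /PM/(indepS GH) GM.
move: {2}#|G :\: F| (leqnn #|G :\: F|) => n.
elim: n F FG FP => [|n IHn] F FG FP.
  rewrite leqn0 cards_eq0 setD_eq0 => GF.
  by have -> : G = F by apply/eqP; rewrite eqEsubset GF.
have [|/set0Pn[x xGF]] := eqVneq (G :\: F) set0.
  move=> /eqP; rewrite setD_eq0 => GF _.
  by have -> : G = F by apply/eqP; rewrite eqEsubset GF.
move=> cGF; have [xF xG] : x \notin F /\ x \in G by move: xGF; rewrite inE => /andP.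
have xFG : x |: F \subset G by rewrite subUset sub1set xG.
apply: (IHn (x |: F)) => //; first by apply: up => //; apply: indepS xFG GM.
by move: cGF; rewrite setUC -setDDl (cardsD1 x) xGF.
Qed.

Lemma modular_filter_restriction M Phi G :
  modular_filter M Phi -> modular_filter (matroid_restriction M G) (restriction Phi G).
Proof.
move=> [/subsetP PM up down]; split.
- by apply/subsetP => F; rewrite !inE => /andP[/PM-> ->].
- by move=> I x; rewrite !inE => /andP[IP _] /andP[/(up _ _ IP)-> ->].
move=> K a b aK bK ab; rewrite !inE => /andP[aP aG] /andP[bP _] /andP[abM _].
by rewrite (down K a b)//= (subset_trans (subsetUr _ _) aG).
Qed.

(** If the join were dependent, [a |: K] and [b |: K] would span each other. *)
Lemma modular_filter_diamond M Phi K a b : modular_filter M Phi ->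
  a \notin K -> b \notin K -> a != b -> a |: K \in Phi -> b |: K \in Phi ->
  mspan M (a |: K) != mspan M (b |: K) ->
  [/\ K \in Phi, b |: (a |: K) \in Phi & b |: (a |: K) \in IN M].
Proof.
move=> [/subsetP PM up down] aK bK ab aP bP sab.
have abM : b |: (a |: K) \in IN M.
  apply: contraNT sab => abM; apply/eqP/esym/mspan_eq; rewrite ?PM//.
    by rewrite !cardsU1 aK bK.
  by rewrite subUset sub1set inE abM orbT (subset_trans (subsetUr _ _) (sub_mspan _ _)).
by split=> //; [exact: down abM | exact: up].
Qed.

Lemma modular_filter_up_set M Phi I x : modular_filter M Phi -> I \in Phi ->
  (x \in ~: mspan M I) && (x |: I \in Phi) = (x \in ~: mspan M I).
Proof.
move=> [/subsetP PM up _] IP; apply: andb_idr.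
by rewrite !inE negb_or negbK => /andP[_]; apply: up.
Qed.

(** If [v] is not spanned by [I], then [v |: I] is independent, hence in [Phi], and [I] is in the
    star. *)
Lemma reduction_mspan M Phi v I : modular_filter M Phi ->
  I \in reduction Phi v -> v \in mspan M I.
Proof.
move=> [_ up _]; rewrite in_reduction => /andP[IP]; rewrite inE.
by case: ifP => //= _; apply: contraNN; apply: up.
Qed.

(** If [v] is outside [I], it is already spanned, so [x |: I] has no partner. If [v] is in [I], a
    partner of [x |: I] would meet [I] in [I :\ v], a partner of [I]. *)
Lemma reduction_up M Phi v I x : modular_filter M Phi ->
  I \in reduction Phi v -> x \notin mspan M I -> x |: I \in reduction Phi v.
Proof.
move=> mP IR xI; have vI := reduction_mspan mP IR; have [PM up down] := mP.
have xv : v != x by apply: contraNneq xI => <-.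
move: xI IR; rewrite inE negb_or negbK => /andP[xI xIM].
rewrite !in_reduction => /andP[IP Iv]; rewrite up//= in_setU1 (negbTE xv)/=.
case: ifPn Iv => vnI; last first.
  move=> _; apply: contraTN vI => /(subsetP PM) vxI; rewrite inE negb_or vnI/= negbK.
  by apply: indepS vxI; apply: setUS; apply: subsetUr.
apply: contraNN => xIv; apply: (down (I :\ v) v x); rewrite ?setD1K//.
- by rewrite !inE eqxx.
- by rewrite !inE negb_and xI orbT.
move: xIv; rewrite setDUl.
have -> // : [set x] :\ v = [set x].
apply/setP => y; rewrite !inE; case: eqP => // ->.
by rewrite andbC (negbTE xv).
Qed.

(** At the bottom, [v] is spanned by [K]. If [v] is outside [K], the partner of [K] is dependent;
    otherwise adding [a] to a partner of [K] would give a partner of [a |: K]. *)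
Lemma reduction_diamond M Phi v K a b : modular_filter M Phi ->
  a \notin K -> b \notin K -> a != b ->
  a |: K \in reduction Phi v -> b |: K \in reduction Phi v ->
  mspan M (a |: K) != mspan M (b |: K) ->
  K \in reduction Phi v /\ b |: (a |: K) \in reduction Phi v.
Proof.
move=> mP aK bK ab aR bR sab; have [PM up down] := mP.
have va := reduction_mspan mP aR; have vb := reduction_mspan mP bR.
have aP : a |: K \in Phi by move: aR; rewrite in_reduction => /andP[].
have bP : b |: K \in Phi by move: bR; rewrite in_reduction => /andP[].
have [KP _ abM] := modular_filter_diamond mP aK bK ab aP bP sab.
have abM' : a |: (b |: K) \in IN M by rewrite setUCA.
split; last first.
  by apply: (reduction_up mP aR); rewrite !inE !negb_or negbK abM eq_sym ab bK.
have vK := mspan_meet aK bK ab abM va vb.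
have va' : v != a.
  by apply: contraTneq vb => ->; rewrite !inE !negb_or negbK abM' ab aK.
rewrite in_reduction KP/=; case: ifPn => vnK; last first.
  by move: vK; rewrite inE (negbTE vnK)/=; apply: contraNN; apply: (subsetP PM).
move: aR; rewrite in_reduction in_setU1 vnK orbT => /andP[_]; apply: contraNN => KvP.
have -> : (a |: K) :\ v = a |: (K :\ v).
  apply/setP => y; rewrite !inE; case: (eqVneq y v) => [->|//].
  by rewrite (negbTE va').
apply: up => //; apply: indepS (subsetP PM _ aP).
by apply: setUS; apply: subsetDl.
Qed.

End ModularFilter.

(** * The defect of the recursion *)

(** Used with [P G] meaning that [v] is in [G]. On the other flats the deletion term, after
    multiplication by [q], cancels the term of the family itself. *)
Lemma defect_sum (A : comNzRingType) (T : finType) (S P : pred T) (q : A)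
    (w w' f g c e : T -> A) :
  (forall G, P G -> w' G = w G) -> (forall G, ~~ P G -> q * w' G = w G) ->
  (forall G, ~~ P G -> g G = f G) ->
  \sum_(G | S G) w G * f G - q * (\sum_(G | S G) w' G * g G)
    - q * (\sum_(G | S G && P G) w G * c G)
    - (1 - q) * (\sum_(G | S G && P G) w G * e G) =
  \sum_(G | S G && P G) w G * (f G - q * g G - q * c G - (1 - q) * e G).
Proof.
move=> wP wN gN; rewrite !mulr_sumr.
rewrite [X in X - _ - _ - _](bigID P) /=.
rewrite [X in _ - X - _ - _](bigID P) /=.
rewrite [X in _ - (_ + X)](eq_bigr (fun G => w G * f G)) => [|G /andP[_ PG]].
  rewrite opprD addrACA subrr addr0 -!sumrB; apply: eq_bigr => G /andP[_ /wP->].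
  by ring.
by rewrite mulrA wN// gN.
Qed.

Section Recursion.
Variables (R : realType) (d : Order.disp_t) (E : finOrderType d).
Implicit Types (M : matroid E) (Phi : {set {set E}}) (F G I J K : {set E}).
Implicit Types (a b v x : E) (k : nat).

Local Notation q := (<< exponent1 R >>) (only parsing).
Local Notation gf := (@spectrum_gf R d E).

Lemma in_faces Phi k F : (F \in faces Phi k) = (F \in Phi) && (#|F| == k).
Proof. by rewrite inE. Qed.

Lemma modular_filter_localize M Phi k : modular_filter M Phi ->
  gf Phi k = \sum_(G in rank_flats M k) q ^+ #|~: G| * gf (restriction Phi G) k.
Proof.
move=> mP; have [/subsetP PM up down] := mP.
apply: (@spectrum_gf_localize R d E _ k (mspan M)).
- by move=> I; rewrite inE => /andP[/PM IM /eqP<-]; apply: mem_rank_flats.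
- by move=> I G; rewrite inE => /andP[/PM IM /eqP Ik]; apply: sub_rank_flat.
- move=> I; rewrite inE => /andP[IP _]; congr #|pred_of_set _|; apply/setP => x.
  by rewrite inE (modular_filter_up_set _ mP).
move=> K a b aK bK ab; rewrite !inE => /andP[aP _] /andP[bP _] sab.
by have [] := modular_filter_diamond mP aK bK ab aP bP sab.
Qed.

(** The vertex [v] no longer counts among the extensions leaving [G], which lowers the exponent by
    one when [v] is outside [G]. *)
Lemma deletion_localize M Phi v k : modular_filter M Phi ->
  gf (deletion Phi v) k = \sum_(G in rank_flats M k)
    q ^+ #|~: G :\ v| * gf (deletion (restriction Phi G) v) k.
Proof.
move=> mP; have [/subsetP PM up down] := mP.
rewrite (@spectrum_gf_localize R d E _ k (mspan M) (rank_flats M k)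
  (fun G => #|~: G :\ v|)).
- by apply: eq_bigr => G _; rewrite restriction_deletion.
- by move=> I; rewrite !inE => /andP[/andP[/PM IM _] /eqP<-]; apply: mem_rank_flats.
- by move=> I G; rewrite !inE => /andP[/andP[/PM IM _] /eqP Ik]; apply: sub_rank_flat.
- move=> I; rewrite !inE => /andP[/andP[IP vI] _]; congr #|pred_of_set _|; apply/setP => x.
  rewrite inE in_deletion andbA (modular_filter_up_set _ mP)//.
  by rewrite in_setU1 negb_or vI andbT eq_sym [RHS]in_setD1 andbC.
move=> K a b aK bK ab; rewrite !inE !negb_or.
move=> /andP[/andP[aP /andP[va vK]] _] /andP[/andP[bP /andP[vb _]] _] sab.
by have [-> -> _] := modular_filter_diamond mP aK bK ab aP bP sab; rewrite va vK vb.
Qed.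

(** A face [I] is labelled by the span of [v |: I], whence the rank [k.+1] and the flats containing
    [v]. *)
Lemma contraction_localize M Phi v k : modular_filter M Phi ->
  gf (contraction Phi v) k = \sum_(G in rank_flats M k.+1 | v \in G)
    q ^+ #|~: G| * gf (contraction (restriction Phi G) v) k.
Proof.
move=> mP; have [/subsetP PM up down] := mP.
transitivity (\sum_(G in [set G in rank_flats M k.+1 | v \in G])
    q ^+ #|~: G| * gf (restriction (contraction Phi v) G) k); last first.
  rewrite [LHS](eq_bigl (fun G => (G \in rank_flats M k.+1) && (v \in G))).
    by apply: eq_bigr => G /andP[_ vG]; rewrite restriction_contraction.
  by move=> G; rewrite inE.
have cvk I : I \in faces (contraction Phi v) k ->
    [/\ v \notin I, v |: I \in Phi, v |: I \in IN M & #|v |: I| = k.+1].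
  rewrite inE in_contraction => /andP[/andP[vI vP] /eqP Ik].
  by rewrite vI vP PM// cardsU1 vI Ik.
apply: (@spectrum_gf_localize R d E _ k (fun I => mspan M (v |: I))).
- move=> I /cvk[vI vP vM Ik]; rewrite inE -Ik mem_rank_flats//=.
  by apply: (subsetP (sub_mspan _ _)); rewrite setU11.
- move=> I G /cvk[vI vP vM Ik]; rewrite inE => /andP[GS vG].
  by rewrite -(sub_rank_flat vM Ik GS) subUset sub1set vG.
- move=> I /cvk[vI vP vM Ik]; congr #|pred_of_set _|; apply/setP => x.
  rewrite inE in_contraction setUCA.
  have [->|xv] := eqVneq x v.
    by rewrite setU11 andbF in_setC inE setU11.
  by rewrite in_setU1 negb_or eq_sym xv vI (modular_filter_up_set _ mP).
move=> K a b aK bK ab /cvk[va aP _ _] /cvk[vb bP _ _].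
rewrite ![v |: (_ |: K)]setUCA in aP bP * => sab.
move: va vb; rewrite !inE !negb_or => /andP[va vK] /andP[vb _].
have [] := modular_filter_diamond mP _ _ ab aP bP sab; rewrite ?inE ?negb_or.
- by rewrite eq_sym va.
- by rewrite eq_sym vb.
by rewrite !in_contraction !inE !negb_or vK va vb ![v |: (_ |: _)]setUCA => -> ->.
Qed.

Lemma reduction_localize M Phi v k : modular_filter M Phi ->
  gf (reduction Phi v) k = \sum_(G in rank_flats M k | v \in G)
    q ^+ #|~: G| * gf (reduction (restriction Phi G) v) k.
Proof.
move=> mP; have [/subsetP PM up down] := mP.
transitivity (\sum_(G in [set G in rank_flats M k | v \in G])
    q ^+ #|~: G| * gf (restriction (reduction Phi v) G) k); last first.
  rewrite [LHS](eq_bigl (fun G => (G \in rank_flats M k) && (v \in G))).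
    by apply: eq_bigr => G /andP[_ vG]; rewrite restriction_reduction.
  by move=> G; rewrite inE.
have RM I : I \in reduction Phi v -> I \in IN M by rewrite in_reduction => /andP[/PM].
apply: (@spectrum_gf_localize R d E _ k (mspan M)).
- move=> I; rewrite inE => /andP[IR /eqP<-].
  by rewrite inE mem_rank_flats ?RM// (reduction_mspan mP).
- move=> I G; rewrite inE => /andP[/RM IM /eqP Ik]; rewrite inE => /andP[GS _].
  exact: sub_rank_flat IM Ik GS.
- move=> I; rewrite inE => /andP[IR _]; congr #|pred_of_set _|; apply/setP => x.
  rewrite inE; apply: andb_idr; rewrite in_setC; exact: reduction_up.
move=> K a b aK bK ab; rewrite !in_faces => /andP[aR _] /andP[bR _].
exact: reduction_diamond mP aK bK ab aR bR.
Qed.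

(** The coefficient of t^k in the difference of both sides of the recursion; the factor t shifts the
    contraction by one. *)
Definition recursion_defect Phi v k : {malg int[exponent R]} :=
  gf Phi k - q * gf (deletion Phi v) k
  - q * (if k is k'.+1 then gf (contraction Phi v) k' else 0)
  - (1 - q) * gf (reduction Phi v) k.

Lemma recursion_defect_localize M Phi v k : modular_filter M Phi ->
  recursion_defect Phi v k = \sum_(G in rank_flats M k | v \in G)
    q ^+ #|~: G| * recursion_defect (restriction Phi G) v k.
Proof.
move=> mP; rewrite /recursion_defect (modular_filter_localize _ mP).
rewrite (deletion_localize _ _ mP) (reduction_localize _ _ mP).
have -> : (if k is k'.+1 then gf (contraction Phi v) k' else 0) =
  \sum_(G in rank_flats M k | v \in G) q ^+ #|~: G| *
    (if k is k'.+1 then gf (contraction (restriction Phi G) v) k' else 0).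
  case: k => [|k]; last by rewrite (contraction_localize _ _ mP).
  by rewrite big1// => G _; rewrite mulr0.
apply: defect_sum => G; last by move=> vG; rewrite deletion_restriction_id.
  move=> vG; congr (_ ^+ _); apply: eq_card => x; rewrite !inE.
  by case: eqVneq => // ->; rewrite vG.
by move=> vG; rewrite -exprS [in RHS](cardsD1 v) inE vG.
Qed.

End Recursion.

(** Shifting the index of the contraction term changes its sign; nothing is lost at the end because
    [c n = 0]. *)
Lemma defect_alternating_sum (A : comNzRingType) n (q sa sb sc se : A)
    (a b c c' e : nat -> A) :
  \sum_(k < n.+1) (-1) ^+ k * a k = sa ->
  \sum_(k < n.+1) (-1) ^+ k * b k = sb ->
  \sum_(k < n.+1) (-1) ^+ k * c k = sc ->
  \sum_(k < n.+1) (-1) ^+ k * e k = se ->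
  c n = 0 -> c' 0%N = 0 -> (forall k, c' k.+1 = c k) ->
  \sum_(k < n.+1) (-1) ^+ k * (a k - q * b k - q * c' k - (1 - q) * e k) =
    sa - q * sb + q * sc - (1 - q) * se.
Proof.
move=> <- <- <- <- cn c'0 c'S.
have -> : \sum_(k < n.+1) (-1) ^+ k * c k = - \sum_(k < n.+1) (-1) ^+ k * c' k.
  rewrite big_ord_recr big_ord_recl /= cn c'0 !mulr0 addr0 add0r -sumrN.
  by apply: eq_bigr => k _; rewrite exprS mulN1r mulNr opprK c'S.
rewrite mulrN !mulr_sumr -!sumrB; apply: eq_bigr => k _; ring.
Qed.

Lemma poly_recursion (A : comNzRingType) (q : A) (p0 p1 p2 p3 : {poly A})
    (f0 f1 f2 f3 : nat -> A) :
  (forall k, p0`_k = f0 k) -> (forall k, p1`_k = f1 k) ->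
  (forall k, p2`_k = f2 k) -> (forall k, p3`_k = f3 k) ->
  (forall k, f0 k - q * f1 k - q * (if k is k'.+1 then f2 k' else 0)
               - (1 - q) * f3 k = 0) ->
  p0 = q%:P * p1 + q%:P * 'X * p2 + (1 - q%:P) * p3.
Proof.
move=> e0 e1 e2 e3 fE; apply/polyP => k; apply/eqP; rewrite -subr_eq0; apply/eqP.
rewrite -mulrA -polyC1 -polyCB !coefD !coefCM coefXM; apply: etrans (fE k).
by rewrite e0 e1 e3; case: k => [|k] /=; rewrite ?e2; ring.
Qed.

(** * Induction on the rank and application to the matroid pair *)

Section Main.
Variables (R : realType) (d : Order.disp_t) (E : finOrderType d).
Implicit Types (M : matroid E) (Phi : {set {set E}}) (F G I J K : {set E}).
Implicit Types (a b v x : E) (k : nat).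

Lemma spectrum_gf0 Phi k : faces Phi k = set0 -> spectrum_gf R Phi k = 0.
Proof. by move=> f0; rewrite /spectrum_gf char_poly_dim0 ?root_gf1// f0 cards0. Qed.

Lemma recursion_defect_alternating_sum Phi v : is_interval Phi ->
  \sum_(k < #|E|.+1) (-1) ^+ k * recursion_defect R Phi v k = 0.
Proof.
move=> iP.
(* A face of the contraction avoids [v], so it cannot have [#|E|] elements. *)
have cn : spectrum_gf R (contraction Phi v) #|E| = 0.
  apply: spectrum_gf0; apply/setP => F; rewrite in_faces in_contraction inE.
  apply/negbTE; rewrite -!andbA; apply/and3P => -[vF _ /eqP FE].
  have : F = setT by apply/eqP; rewrite eqEcard subsetT cardsT FE leqnn.
  by move=> FT; rewrite FT inE in vF.
pose c k : {malg int[exponent R]} :=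
  if k is k'.+1 then spectrum_gf R (contraction Phi v) k' else 0.
have sD := spectrum_gf_euler R (deletion_interval (v := v) iP).
have sC := spectrum_gf_euler R (contraction_interval (v := v) iP).
have sR := spectrum_gf_euler R (reduction_interval (v := v) iP).
have := defect_alternating_sum << exponent1 R >> (c' := c)
  (spectrum_gf_euler R iP) sD sC sR cn erefl (fun=> erefl).
(* With D and C the Euler characteristics of deletion and contraction, the sum is (D - C) - q D + q
   C - (1 - q)(D - C) = 0. *)
rewrite euler_char_reduction (euler_char_deletion_contraction _ Phi v).
move=> defectE; apply: etrans defectE _; ring.
Qed.

Lemma recursion_defect_eq0 M Phi v k :
  modular_filter M Phi -> recursion_defect R Phi v k = 0.
Proof.
have [n] : exists n, forall I, I \in IN M -> (#|I| <= n)%N.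
  by exists #|E| => I _; apply: max_card.
elim/ltn_ind: n M Phi k => n IHn M Phi k Mn mP.
(* The restriction to a flat of rank [j] has no independent set larger than [j], so the induction
   hypothesis applies to it. *)
have low j : (j < n)%N -> recursion_defect R Phi v j = 0.
  move=> jn; rewrite (recursion_defect_localize _ _ _ mP) big1// => G /andP[].
  move=> /imsetP[I]; rewrite inE => /andP[IM /eqP Ij] -> _.
  rewrite (IHn j jn _ _ j _ (modular_filter_restriction (mspan M I) mP)) ?mulr0//.
  by move=> J; rewrite inE => /andP[JM JI]; rewrite -Ij (mspan_rank IM JM JI).
have none j : (forall I, I \in IN M -> #|I| <> j) -> recursion_defect R Phi v j = 0.
  move=> Mj; have [/subsetP PM _ _] := mP.
  have noface (Psi : {set {set E}}) : Psi \subset Phi -> spectrum_gf R Psi j = 0.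
    move=> /subsetP sub; apply: spectrum_gf0; apply/setP => F; rewrite in_faces inE.
    by apply/negbTE/andP => -[/sub/PM/Mj FE /eqP].
  rewrite /recursion_defect !noface //.
  - case: j Mj {noface} => [|j] Mj; first by rewrite !mulr0 !subr0.
    rewrite spectrum_gf0 ?mulr0 ?subr0//; apply/setP => F.
    rewrite in_faces in_contraction inE; apply/negbTE/andP => -[/andP[vF FP] /eqP Fj].
    by apply: (Mj _ (PM _ FP)); rewrite cardsU1 vF Fj.
  - by apply/subsetP => F; rewrite in_reduction => /andP[].
  by apply/subsetP => F; rewrite in_deletion => /andP[].
have [/low//|nk] := ltnP k n.
have [noI|[I]] := set_0Vmem (faces (IN M) k).
  apply: none => I IM Ik; have : I \in faces (IN M) k by rewrite in_faces IM Ik eqxx.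
  by rewrite noI inE.
rewrite in_faces => /andP[IM /eqP Ik].
have kn : k = n by apply/eqP; rewrite eqn_leq nk -Ik Mn.
have kE : (k < #|E|.+1)%N by rewrite ltnS -Ik max_card.
(* Here [k] is the rank: the other terms vanish by [low] and [none], and the remaining one is the
   defect up to sign. *)
have := recursion_defect_alternating_sum v (modular_filter_interval mP).
rewrite (bigD1 (Ordinal kE)) //= big1 => [|j jk].
  rewrite addr0 => /(congr1 ( *%R ((-1) ^+ k))).
  by rewrite mulr0 mulrA -expr2 sqrr_sign mul1r.
have [jlt|] := ltnP j n; first by rewrite low ?mulr0.
rewrite leq_eqVlt => /orP[/eqP jn|jn].
  by case/eqP: jk; apply: val_inj; rewrite /= -jn.
rewrite none ?mulr0// => J JM Jj.
by have := Mn J JM; rewrite Jj leqNgt jn.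
Qed.

Lemma coef_spectrum_poly Phi k : (spectrum_poly R Phi)`_k = spectrum_gf R Phi k.
Proof.
rewrite /spectrum_poly coef_sum.
under eq_bigr do rewrite -spectrum_gfE coefMC coefXn.
have [kE|kE] := ltnP k #|E|.+1.
  rewrite (bigD1 (Ordinal kE)) //= eqxx mul1r big1 ?addr0// => j jk.
  rewrite [_ == _](_ : _ = false) ?mul0r//; apply/negbTE.
  by apply: contraNneq jk => kj; apply/eqP/val_inj.
rewrite big1 => [|j _]; last by rewrite gtn_eqF ?mul0r// (leq_trans _ kE).
rewrite spectrum_gf0//; apply/setP => F; rewrite in_faces inE.
by rewrite (ltn_eqF (leq_ltn_trans (max_card _) kE)) andbF.
Qed.

Lemma modular_filter_spectral_recursion M Phi :
  modular_filter M Phi -> spectral_recursion R Phi.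
Proof.
move=> mP v; apply: (poly_recursion (coef_spectrum_poly Phi)
  (coef_spectrum_poly (deletion Phi v)) (coef_spectrum_poly (contraction Phi v))
  (coef_spectrum_poly (reduction Phi v))) => k.
exact: recursion_defect_eq0 v k mP.
Qed.

Lemma relative_pair_modular_filter M (e : E) :
  modular_filter M (relative_pair (IN_del M e) (IN_contr M e)).
Proof.
(* Being outside the contraction means that [e |: F] is dependent. If [e] is a loop, this holds for
   every [F]. *)
have inP F : (F \in relative_pair (IN_del M e) (IN_contr M e)) =
    [&& F \in IN M, e \notin F & e \in mspan M F].
  rewrite inE in_contraction in_deletion inE.
  by case: (F \in IN M); case: (e \in F); rewrite /= ?andbF// andbT.
split.
- by apply/subsetP => F; rewrite inP => /and3P[].
- move=> I x; rewrite !inP => /and3P[IM eI se] xM; rewrite xM.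
  rewrite (subsetP (mspan_mono M (subsetUr _ _)) _ se) andbT in_setU1 negb_or eI andbT.
  by move: se; rewrite inE (negbTE eI)/=; apply: contraNneq => ->.
(* Closure under meets is [mspan_meet] applied to the element [e]. *)
move=> K a b aK bK ab; rewrite !inP => /and3P[aM ea sa] /and3P[bM _ sb] abM.
rewrite (mspan_meet aK bK ab abM sa sb) (indepS (subsetUr _ _) aM) andbT /=.
by apply: contraNN ea => eK; rewrite in_setU1 eK orbT.
Qed.

End Main.

Theorem theorem6p2 (R : realType) (d : Order.disp_t) (E : finOrderType d)
    (M : matroid E) (e : E) :
  is_interval (relative_pair (IN_del M e) (IN_contr M e)) /\
  spectral_recursion R (relative_pair (IN_del M e) (IN_contr M e)).
Proof.
have mP := relative_pair_modular_filter M e; split.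
  exact: modular_filter_interval mP.
exact: modular_filter_spectral_recursion mP.
Qed.
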